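(* Let $\mathcal H$ be a real Hilbert space, $I=\{1,\dots,m\}$, and for every $i\in I$ let $U_i\colon\mathcal H\to\mathcal H$ be a cutter, $p_i\colon\mathcal H\to[0,\infty)$ a function, and $C_i\subseteq\mathcal H$ a set with $C_i=\operatorname{Fix}U_i=p_i^{-1}(0)$. Assume $C:=\bigcap_{i\in I}C_i\neq\emptyset$. Let the sequence $\{x^k\}_{k=0}^\infty$ be defined by $$x^0\in\mathcal H;\qquad x^{k+1}:=x^k+\alpha_k\Big(\sum_{i\in I_k}\omega_i^kU_ix^k-x^k\Big)\quad\text{for }k=0,1,2,\ldots,$$ where $I_k\subseteq J_k\subseteq I$, $\alpha_k\in(0,2)$ and $\omega_i^k\in(0,1]$ ($i\in I_k$) are such that $\sum_{i\in I_k}\omega_i^k=1$. Assume that (i) $\alpha_k\in[\alpha^-,\alpha^+]$ and $\omega_i^k\in[\omega^-,1]$ for all $k$ and all $i\in I_k$, where $\alpha^-,\omega^-\in(0,1]$ and $\alpha^+\in[1,2)$; (ii) $I=J_k\cup\ldots\cup J_{k+s-1}$ for every $k=0,1,2,\ldots$ and some integer $s\geq1$; (iii) for each $k=0,1,2,\ldots$, $I_k\cap\operatorname{Argmax}_{j\in J_k}p_j(x^k)\neq\emptyset$; (iv) for $r=d(x^0,C)>0$, there are numbers $\delta_r,\Delta_r>0$ such that for every $x\in B(P_Cx^0,r)$ and $i\in I$, $$\delta_rd(x,C_i)\leq p_i(x)\leq\Delta_r\|U_ix-x\|.$$ If the family $\mathcal C:=\{\operatorname{Fix}U_i\mid i\in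 I\}$ is $\kappa_r$-linearly regular over $B(P_Cx^0,r)$, then $\{x^k\}_{k=0}^\infty$ converges linearly to some point $x^\infty\in C$, that is, $\|x^k-x^\infty\|\leq c_rq_r^k$ for every $k=0,1,2,\dots$, where $$c_r=\frac{2d(x^0,C)}{q_r^{s-1}}\qquad\text{and}\qquad q_r=\sqrt[2s]{1-\frac{\omega^-(2-\alpha^+)(\alpha^-)^2}{s\,\alpha^+}\cdot\left(\frac{\delta_r}{\kappa_r\Delta_r}\right)^2}.$$ Moreover (error bound), for every $k=0,1,2,\ldots$, $$\frac{\delta_r}{2\kappa_r}\|x^k-x^\infty\|\leq\max_{i\in I}p_i(x^k)\leq\Delta_rc_rq_r^k.$$
   Context: For an operator $U\colon\mathcal H\to\mathcal H$, $\operatorname{Fix}U:=\{z\in\mathcal H\mid Uz=z\}$. $U$ is a cutter if $\operatorname{Fix}U\neq\emptyset$ and $\langle z-Ux,x-Ux\rangle\leq0$ for all $x\in\mathcal H$ and $z\in\operatorname{Fix}U$ (the fixed point set of a cutter is closed and convex). $d(x,C):=\inf_{z\in C}\|x-z\|$, and $P_C$ is the metric projection onto the nonempty closed convex set $C$. $B(z,r)=\{x\in\mathcal H\mid\|x-z\|\leq r\}$ is the closed ball. $\operatorname{Argmax}_{j\in J}a_j$ is the set of all indices $j\in J$ at which the maximum of $a_j$ over $J$ is attained. A finite family $\{C_i\mid i\in I\}$ of closed convex sets with $C:=\bigcap_{i\in I}C_i\neq\emptyset$ is $\kappa_r$-linearly regular over a set $S$ (with a constant $\kappa_r>0$) if $d(x,C)\leq\kappa_r\max_{i\in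 I}d(x,C_i)$ for every $x\in S$. *)

(* Defs.v *)
From HB Require Import structures.
From mathcomp Require Import all_boot all_order all_algebra.
From mathcomp Require Import all_classical all_reals all_analysis.

Set Implicit Arguments.
Unset Strict Implicit.
Unset Printing Implicit Defensive.

Import Order.TTheory GRing.Theory Num.Theory.
Import numFieldNormedType.Exports.

Local Open Scope classical_set_scope.
Local Open Scope ring_scope.

(* MathComp-Analysis.  A real Hilbert space is a complete normed module [H]
   over a [realType] together with a positive definite symmetric bilinear form
   [dot : {dot H for idfun}] inducing its norm. *)
Definition induces_norm (R : realType) (H : normedModType R)
    (dot : {dot H for idfun}) :=
  forall x : H, `|x| ^+ 2 = dot x x.

Definition Fix (T : Type) (U : T -> T) : set T := [set z | U z = z].

Definition cutter (R : realType) (H : normedModType R)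
    (dot : {dot H for idfun}) (U : H -> H) :=
  Fix U !=set0 /\
  forall x z : H, Fix U z -> dot (z - U x) (x - U x) <= 0.

(* [inf] returns 0 on the empty set: [dist x C] is meaningful for nonempty C. *)
Definition dist (R : realType) (H : normedModType R) (x : H) (C : set H) : R :=
  inf [set `|x - z| | z in C].

(* Well defined for C nonempty, closed and convex in a Hilbert space, where the
   set of nearest points is a singleton; otherwise the value is unspecified. *)
Definition metric_proj (R : realType) (H : normedModType R)
    (C : set H) (x : H) : H :=
  xget x [set y | C y /\ `|x - y| = dist x C].

(* Maximum of a finite family of nonnegative reals: 0 is then neutral. *)
Definition fmax (R : realType) (m : nat) (a : 'I_m -> R) : R :=
  \big[Num.max/0]_(i < m) a i.

Definition linearly_regular (R : realType) (H : normedModType R) (m : nat)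
    (D : 'I_m -> set H) (S : set H) (kappa : R) :=
  0 < kappa /\
  forall x : H, S x ->
    dist x (\bigcap_i D i) <= kappa * fmax (fun i => dist x (D i)).

Definition Argmax (R : realType) (m : nat) (J : {set 'I_m}) (a : 'I_m -> R) :
    {set 'I_m} :=
  [set i in J | [forall j in J, a j <= a i]]%SET.

(* [0 <= q] and not [0 < q]: the rate may vanish (one-step convergence). *)
Definition converges_linearly (R : realType) (H : normedModType R)
    (x : nat -> H) (l : H) (c q : R) :=
  [/\ 0 <= q, q < 1 & forall k : nat, `|x k - l| <= c * q ^+ k].

(* For a >= 0 and n > 0. *)
Definition nth_root (R : realType) (n : nat) (a : R) : R := a `^ (n%:R^-1).

(* Main.v *)
Require Import Defs.
From HB Require Import structures.
From mathcomp Require Import all_boot all_order all_algebra.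
From mathcomp Require Import all_classical all_reals all_analysis.
From mathcomp Require Import ring lra.

Set Implicit Arguments.
Unset Strict Implicit.
Unset Printing Implicit Defensive.

Import Order.TTheory GRing.Theory Num.Theory.
Import numFieldNormedType.Exports.

Local Open Scope classical_set_scope.
Local Open Scope ring_scope.

(** Fejer monotonicity does all the work. Write u_i = U_i x - x. A cutter
satisfies [dot (x - z) u_i <= - |u_i| ^ 2] for each of its fixed points z
([cutter_dot]), so by convexity of the squared norm one iteration decreases
|x - z| ^ 2, for every z in C, by at least alpha (2 - alpha) e, where e is the
weighted mean of the |u_i| ^ 2 ([relaxed_step]). The orbit thus never moves away
from a point of C; in particular it stays in the ball around the projection of
x_0, where the local hypotheses apply.

This decrease pays for two quantities: the squared length of the step, and the
squared displacement |u_j| ^ 2 of any operator used in that step. Fix k, let y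
be the point of C nearest to x_k, and let i be any index. It lies in J_l for
some l in {k, ..., k + s - 1}, and an operator j that maximizes p_j(x_l) over
J_l is used at time l, so that

  d(x_k, C_i) <= |x_k - x_l| + d(x_l, C_i)
              <= |x_k - x_l| + (Delta / delta) |u_j|.

Splitting |x_k - x_l| into steps makes the right-hand side a sum of at most s
terms, each of whose squares is paid for by the decrease at its own time;
Cauchy-Schwarz then bounds its square by
s K (|x_k - y| ^ 2 - |x_(k+s) - y| ^ 2) ([sqr_path_le]), where K is a constant
given by the parameters ([relaxation_constant_bounds]). Since y is nearest to
x_k, linear regularity gives

  d(x_k, C) ^ 2 <= kappa ^ 2 s K (d(x_k, C) ^ 2 - d(x_(k+s), C) ^ 2),

a contraction of the distance to C by the factor q ^ s over each cycle, hence
d(x_k, C) <= d(x_0, C) q ^ k / q ^ (s - 1), because d(x_k, C) is nonincreasing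
in k ([geometric_decay_of_periodic]). Fejer monotonicity with respect to the
point of C nearest to x_k gives |x_l - x_k| <= 2 d(x_k, C) for l >= k, so the
orbit is Cauchy and its limit lies within 2 d(x_k, C) of x_k
([cauchy_tail_limit]). The error bounds follow by comparing d(x_k, C) and |u_i|
with p_i.

Nearest points exist because the fixed point set of a cutter is closed and
convex and the space is complete ([nearest_point_exists]). *)

(** * Weighted sums of real numbers *)

Section WeightedSums.
Variable R : realFieldType.

(** The gap between the two sides is the weighted variance of [a]. *)
Lemma sqr_weighted_mean_le (J : Type) (r : seq J) (P : pred J) (w a : J -> R) :
  (forall i, P i -> 0 <= w i) -> \sum_(i <- r | P i) w i = 1 ->
  (\sum_(i <- r | P i) w i * a i) ^+ 2 <= \sum_(i <- r | P i) w i * a i ^+ 2.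
Proof.
move=> w0 w1; set S := \sum_(i <- r | P i) w i * a i.
rewrite -subr_ge0.
suff -> : \sum_(i <- r | P i) w i * a i ^+ 2 - S ^+ 2 =
          \sum_(i <- r | P i) w i * (a i - S) ^+ 2.
  by apply: sumr_ge0 => i Pi; rewrite mulr_ge0 ?w0 ?sqr_ge0.
have -> : \sum_(i <- r | P i) w i * (a i - S) ^+ 2 =
    \sum_(i <- r | P i) (w i * a i ^+ 2 - 2 * S * (w i * a i) + S ^+ 2 * w i).
  by apply: eq_bigr => i _; ring.
by rewrite big_split /= sumrB -!mulr_sumr w1 -/S; ring.
Qed.

Lemma sqr_sum_le n (a : 'I_n -> R) :
  (\sum_i a i) ^+ 2 <= n%:R * \sum_i a i ^+ 2.
Proof.
case: n a => [|n] a; first by rewrite !big_ord0 mul0r expr0n.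
have n0 : n.+1%:R != 0 :> R by rewrite pnatr_eq0.
have w1 : \sum_(i < n.+1) n.+1%:R^-1 = 1 :> R.
  by rewrite sumr_const card_ord -[LHS]mulr_natl divff.
have := sqr_weighted_mean_le a _ w1.
rewrite -!mulr_sumr exprMn => H.
have {}H : n.+1%:R^-1 ^+ 2 * (\sum_i a i) ^+ 2 <= n.+1%:R^-1 * \sum_i a i ^+ 2.
  by apply: H => i _; rewrite invr_ge0.
have n1 : 0 < n.+1%:R :> R by rewrite ltr0n.
by rewrite expr2 -mulrA ler_pM2l ?invr_gt0// ler_pdivrMl in H.
Qed.

End WeightedSums.

(** * Distance to a set *)

Section Distance.
Variables (R : realType) (H : normedModType R).
Implicit Types (x y z : H) (C D : set H).

Lemma dist_has_lbound x C : has_lbound [set `|x - z| | z in C].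
Proof. by exists 0 => _ [z _ <-]. Qed.

Lemma dist_ge0 x C : 0 <= dist x C.
Proof.
have [->|/set0P[z Cz]] := eqVneq C set0; first by rewrite /dist image_set0 inf0.
by apply: lb_le_inf => [|_ [? _ <-]//]; exists `|x - z|, z.
Qed.

Lemma dist_le x z C : C z -> dist x C <= `|x - z|.
Proof. by move=> Cz; apply: ge_inf; [exact: dist_has_lbound|exists z]. Qed.

Lemma le_dist x C (a : R) :
  C !=set0 -> (forall z, C z -> a <= `|x - z|) -> a <= dist x C.
Proof.
move=> [z Cz] aC; apply: lb_le_inf => [|_ [y /aC ? <-]//].
by exists `|x - z|, z.
Qed.

Lemma dist_triangle x y C : dist x C <= `|x - y| + dist y C.
Proof.
have [->|/set0P C0] := eqVneq C set0.
  by rewrite /dist !image_set0 inf0 addr0.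
rewrite -lerBlDl; apply: le_dist => // z Cz.
by rewrite lerBlDl (le_trans (dist_le x Cz))// ler_distD.
Qed.

Lemma dist_subset x C D : C !=set0 -> C `<=` D -> dist x D <= dist x C.
Proof. by move=> C0 CD; apply: le_dist => // z /CD; apply: dist_le. Qed.

End Distance.

(** * Limits of Cauchy sequences *)

(** Completeness in quantitative form: an a priori bound on the tails of a
sequence survives in the limit, because closed balls are closed. *)
Lemma cauchy_tail_limit (R : realType) (H : completeNormedModType R)
    (u : nat -> H) (b : nat -> R) :
  b @ \oo --> 0 -> (forall k l, (k <= l)%N -> `|u l - u k| <= b k) ->
  exists2 L, u @ \oo --> L & forall k, `|u k - L| <= b k.
Proof.
move=> b0 ub.
have /cauchy_cvg ucvg : cauchy (u @ \oo).
  apply: cauchy_exP => e e0.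
  have [N bN] : exists N, b N < e by exact: filter_ex (cvgr_lt _ b0 _ e0).
  exists (u N); exists N => // n /= Nn; rewrite -ball_normE /ball_ /= distrC.
  exact: le_lt_trans (ub _ _ Nn) bN.
exists (lim (u @ \oo)) => // k; rewrite distrC.
have cB : closed [set z : H | `|z - u k| <= b k].
  have := @closed_closed_ball_ _ _ (u k) (b k).
  by congr closed; apply/seteqP; split => z; rewrite /closed_ball_ /= distrC.
by apply: (closed_cvg _ cB _ _ ucvg); exists k => // l /= /ub.
Qed.

(** * Cutters *)

Section Hilbert.
Variables (R : realType) (H : normedModType R) (dot : {dot H for idfun}).
Hypothesis hdot : induces_norm dot.
Implicit Types (x y z u v w : H) (C : set H).

Lemma dotC x y : dot x y = dot y x.
Proof. by rewrite hermC expr0 mul1r. Qed.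

Lemma dotDl x y z : dot (x + y) z = dot x z + dot y z.
Proof. exact: linearDl. Qed.

Lemma dotNl x y : dot (- x) y = - dot x y.
Proof. exact: linearNl. Qed.

Lemma dotZl a x y : dot (a *: x) y = a * dot x y.
Proof. exact: (linearZl_LR dot). Qed.

Lemma dotNr x y : dot x (- y) = - dot x y.
Proof. exact: linearNr. Qed.

Lemma dotDr x y z : dot x (y + z) = dot x y + dot x z.
Proof. exact: linearDr. Qed.

Lemma dotZr a x y : dot x (a *: y) = a * dot x y.
Proof. exact: linearZr_LR. Qed.

Lemma dot_sumr (J : Type) (r : seq J) (P : pred J) x (F : J -> H) :
  dot x (\sum_(i <- r | P i) F i) = \sum_(i <- r | P i) dot x (F i).
Proof. exact: linear_sumr. Qed.

Lemma sqr_normD x y : `|x + y| ^+ 2 = `|x| ^+ 2 + 2 * dot x y + `|y| ^+ 2.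
Proof.
by rewrite !hdot dotDl !dotDr (dotC y x); ring.
Qed.

Lemma sqr_normB x y : `|x - y| ^+ 2 = `|x| ^+ 2 - 2 * dot x y + `|y| ^+ 2.
Proof. by rewrite sqr_normD normrN dotNr mulrN. Qed.

(** The parallelogram law for [x - y] and [x - z]. *)
Lemma sqr_dist_midpoint x y z :
  `|y - z| ^+ 2 = 2 * `|x - y| ^+ 2 + 2 * `|x - z| ^+ 2
                  - 4 * `|x - 2^-1 *: (y + z)| ^+ 2.
Proof.
have -> : 4 * `|x - 2^-1 *: (y + z)| ^+ 2 = `|(x - y) + (x - z)| ^+ 2.
  have -> : (x - y) + (x - z) = 2 *: (x - 2^-1 *: (y + z)).
    rewrite scalerBr scalerA divff ?pnatr_eq0// scale1r scaler_nat mulr2n.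
    by rewrite opprD addrACA.
  by rewrite normrZ exprMn ger0_norm; [congr (_ * _); ring|].
have -> : y - z = (x - z) - (x - y) by rewrite opprB [RHS]addrC subrKA.
rewrite (sqr_normD (x - y) (x - z)) (sqr_normB (x - z) (x - y)) (dotC (x - z)).
by ring.
Qed.

(** Expand the cutter inequality along [z - U x = - ((x - z) + (U x - x))]. *)
Lemma cutter_dot U x z : cutter dot U -> Fix U z ->
  dot (x - z) (U x - x) <= - `|U x - x| ^+ 2.
Proof.
move=> [_ cU] /(cU x); rewrite hdot.
have -> : z - U x = - ((x - z) + (U x - x)).
  by rewrite [in RHS]addrC subrKA opprB.
have -> : x - U x = - (U x - x) by rewrite opprB.
by rewrite dotNl dotNr opprK dotDl => ?; lra.
Qed.

(** Expand [0 <= |(x - z) + (U x - x)| ^+ 2], whose double product is at most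
[- 2 * |U x - x| ^+ 2]. *)
Lemma cutter_displacement_le U x z : cutter dot U -> Fix U z ->
  `|U x - x| <= `|x - z|.
Proof.
move=> cU /(cutter_dot x cU) xz; rewrite -ler_sqr ?nnegrE//.
have := sqr_ge0 `|(x - z) + (U x - x)|; rewrite sqr_normD; lra.
Qed.

Lemma cutter_displacement_le_dist U x : cutter dot U ->
  `|U x - x| <= dist x (Fix U).
Proof.
by move=> cU; apply: le_dist => [|z]; [case: cU|exact: cutter_displacement_le].
Qed.

(** A limit z of fixed points is displaced by at most its distance to each of
them, hence not at all. *)
Lemma cutter_Fix_closed U : cutter dot U -> closed (Fix U).
Proof.
move=> cU z zU; apply/eqP; rewrite -subr_eq0 -normr_le0.
apply/ler_addgt0Pr => e e0; rewrite add0r.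
have [y [Uy]] := zU _ (nbhsx_ballx z e e0).
rewrite -ball_normE /ball_ /= => /ltW; apply: le_trans.
exact: cutter_displacement_le.
Qed.

(** The cutter inequality at the midpoint w is affine in the fixed point;
averaging its instances for y and z puts w itself in their place, and reads
[|w - U w| ^+ 2 <= 0]. *)
Lemma cutter_Fix_midpoint U y z : cutter dot U ->
  Fix U y -> Fix U z -> Fix U (2^-1 *: (y + z)).
Proof.
move=> [_ cU] Uy Uz; set w := 2^-1 *: (y + z).
have wE a : dot (w - U w) a = 2^-1 * (dot (y - U w) a + dot (z - U w) a).
  rewrite -dotDl -dotZl; congr (dot _ _).
  rewrite addrACA scalerDr -/w; congr (_ + _).
  rewrite -opprD -mulr2n -(scaler_nat 2 (U w)) scalerN scalerA mulVf ?pnatr_eq0//.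
  by rewrite scale1r.
have : `|w - U w| ^+ 2 <= 0.
  rewrite hdot wE pmulr_rle0 ?invr_gt0//.
  by have := cU w _ Uy; have := cU w _ Uz; lra.
rewrite real_exprn_even_le0 ?num_real//= normr_eq0 subr_eq0 => /eqP; exact: esym.
Qed.

End Hilbert.

(** * Nearest points *)

(** Two points of C that nearly minimize the distance to x have their midpoint in
C, hence no closer to x than [dist x C]; by the parallelogram law they are close
to each other, so that minimizing sequences are Cauchy. *)
Lemma nearest_point_exists (R : realType) (H : completeNormedModType R)
    (dot : {dot H for idfun}) (hdot : induces_norm dot) (C : set H) (x : H) :
  C !=set0 -> closed C -> (forall y z, C y -> C z -> C (2^-1 *: (y + z))) ->
  exists2 y, C y & `|x - y| = dist x C.
Proof.
move=> C0 clC midC; set d := dist x C.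
have d0 : 0 <= d := dist_ge0 x C.
(* The minimizing points are measured by the squared distance, so that the
   parallelogram law yields a Cauchy bound linear in e. *)
have near_dist (e : R) : 0 < e -> {y | C y /\ `|x - y| ^+ 2 <= d ^+ 2 + e ^+ 2}.
  move=> e0; apply: cid; apply: contrapT => noy.
  have : Num.sqrt (d ^+ 2 + e ^+ 2) <= d.
    apply: le_dist => // y Cy; rewrite -(ger0_norm (normr_ge0 (x - y))).
    rewrite -sqrtr_sqr ler_wsqrtr// leNgt; apply/negP => /ltW yd.
    by apply: noy; exists y.
  rewrite -{2}(ger0_norm d0) -sqrtr_sqr ler_sqrt ?sqr_ge0//.
  by have := exprn_gt0 2 e0; lra.
pose e n : R := n.+1%:R^-1.
have e0 n : 0 < e n by rewrite invr_gt0.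
pose y n := sval (near_dist (e n) (e0 n)).
have Cy n : C (y n) by have [] := svalP (near_dist (e n) (e0 n)).
have yd n : `|x - y n| ^+ 2 <= d ^+ 2 + e n ^+ 2.
  by have [] := svalP (near_dist (e n) (e0 n)).
have [L yL eL] : exists2 L, y @ \oo --> L & forall k, `|y k - L| <= 2 * e k.
  apply: cauchy_tail_limit => [|k l kl].
    rewrite -[X in _ --> X](mulr0 2); apply: cvgMr; exact: cvg_harmonic.
  rewrite -ler_sqr ?nnegrE ?mulr_ge0 ?(ltW (e0 _))//.
  rewrite (sqr_dist_midpoint hdot x).
  have : d ^+ 2 <= `|x - 2^-1 *: (y l + y k)| ^+ 2.
    by rewrite ler_sqr ?nnegrE//; apply: dist_le; exact: midC.
  have : e l ^+ 2 <= e k ^+ 2.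
    rewrite ler_sqr ?nnegrE ?(ltW (e0 _))// lef_pV2 ?posrE//.
    by rewrite ler_nat.
  by have := yd k; have := yd l; rewrite exprMn; lra.
have CL : C L.
  by apply: (closed_cvg _ clC _ _ yL); exists 0%N.
exists L => //; apply/eqP; rewrite eq_le dist_le// andbT.
apply/ler_addgt0Pr => eps eps0.
have [n en] : exists n, 3 * e n < eps.
  have h0 : 3 * harmonic n @[n --> \oo] --> (0 : R).
    rewrite -[X in _ --> X](mulr0 3); apply: cvgMr; exact: cvg_harmonic.
  exact: filter_ex (cvgr_lt _ h0 _ eps0).
have yn : `|x - y n| <= d + e n.
  rewrite -ler_sqr ?nnegrE ?addr_ge0 ?(ltW (e0 _))//.
  apply: (le_trans (yd n)); rewrite sqrrD.
  by have := mulr_ge0 d0 (ltW (e0 n)); lra.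
have := ler_distD (y n) x L; have := eL n; rewrite -/d; lra.
Qed.

Lemma metric_projP (R : realType) (H : completeNormedModType R)
    (dot : {dot H for idfun}) (hdot : induces_norm dot) (C : set H) (x : H) :
  C !=set0 -> closed C -> (forall y z, C y -> C z -> C (2^-1 *: (y + z))) ->
  C (metric_proj C x) /\ `|x - metric_proj C x| = dist x C.
Proof.
move=> C0 clC midC; have [y Cy yd] := nearest_point_exists hdot x C0 clC midC.
by apply: (@xgetPex _ x [set y | C y /\ _]); exists y.
Qed.

(** * One step and one cycle of the iteration *)

(** Expanding the square of [(x - z) + a *: v], the cross term is at most
[- 2 * a * e] and the last one at most [a ^+ 2 * e]. *)
Lemma relaxed_step (R : realType) (H : normedModType R)
    (dot : {dot H for idfun}) (hdot : induces_norm dot)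
    (J : Type) (r : seq J) (P : pred J) (w : J -> R) (u : J -> H)
    (x z : H) (a : R) :
  0 <= a -> (forall i, P i -> 0 <= w i) -> \sum_(i <- r | P i) w i = 1 ->
  (forall i, P i -> dot (x - z) (u i) <= - `|u i| ^+ 2) ->
  let v := \sum_(i <- r | P i) w i *: u i in
  let e := \sum_(i <- r | P i) w i * `|u i| ^+ 2 in
  `|v| ^+ 2 <= e /\ `|x + a *: v - z| ^+ 2 <= `|x - z| ^+ 2 - a * (2 - a) * e.
Proof.
move=> a0 w0 w1 hu v e.
have ve : `|v| ^+ 2 <= e.
  apply: le_trans (sqr_weighted_mean_le (fun i => `|u i|) w0 w1).
  rewrite ler_sqr ?nnegrE//; last first.
    by apply: sumr_ge0 => i Pi; rewrite mulr_ge0 ?w0.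
  apply: (le_trans (ler_norm_sum _ _ _)); apply: ler_sum => i Pi.
  by rewrite normrZ ger0_norm ?w0.
split=> //.
have dv : dot (x - z) v <= - e.
  rewrite (dot_sumr dot) -sumrN; apply: ler_sum => i Pi.
  by rewrite (dotZr dot) -mulrN ler_wpM2l ?w0 ?hu.
rewrite addrAC (sqr_normD hdot (x - z)) (dotZr dot) normrZ exprMn.
rewrite real_normK ?num_real//.
have := ler_wpM2l (sqr_ge0 a) ve; have := ler_wpM2l a0 dv; lra.
Qed.

(** The steps from time k to time l, together with b, are at most s numbers, each
with its square bounded by the decrease of [K * |x n - z| ^+ 2] at a different
time n between k and l; Cauchy-Schwarz applies, and the decreases telescope. *)
Lemma sqr_path_le (R : realType) (H : normedModType R) (x : nat -> H) (z : H)
    (K b : R) (k l s : nat) :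
  0 < K -> (k <= l < k + s)%N ->
  (forall n, `|x n.+1 - x n| ^+ 2 <=
     K * (`|x n - z| ^+ 2 - `|x n.+1 - z| ^+ 2)) ->
  0 <= b -> b ^+ 2 <= K * (`|x l - z| ^+ 2 - `|x l.+1 - z| ^+ 2) ->
  (`|x k - x l| + b) ^+ 2 <=
    s%:R * (K * (`|x k - z| ^+ 2 - `|x (k + s)%N - z| ^+ 2)).
Proof.
move=> K0 /andP[kl lks] hx b0 hb.
pose D n := `|x n - z| ^+ 2.
have D_mono : {homo D : i j / (i <= j)%N >-> j <= i}.
  apply/nonincreasing_seqP => n.
  have := le_trans (sqr_ge0 _) (hx n).
  by rewrite pmulr_rge0// subr_ge0.
have [n lE] : exists n, l = (k + n)%N by exists (l - k)%N; rewrite subnKC.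
subst l; rewrite ltn_add2l in lks.
have path_len j : `|x k - x (k + j)%N| <=
    \sum_(i < j) `|x (k + i).+1 - x (k + i)%N|.
  elim: j => [|j IHj]; first by rewrite addn0 subrr normr0 big_ord0.
  rewrite big_ord_recr /= addnS (le_trans (ler_distD (x (k + j)%N) _ _))//.
  by rewrite lerD// distrC.
pose f (i : 'I_n.+1) := if i == n :> nat then b
  else `|x (k + i).+1 - x (k + i)%N|.
have f_sum : \sum_i f i = \sum_(i < n) `|x (k + i).+1 - x (k + i)%N| + b.
  rewrite big_ord_recr /= {2}/f eqxx; congr (_ + _); apply: eq_bigr => i _.
  by rewrite /f /= ltn_eqF.
have f_sqr i : f i ^+ 2 <= K * (D (k + i)%N - D (k + i).+1).
  by rewrite /f; case: eqP => [->|_]; [exact: hb|exact: hx].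
have f_le : `|x k - x (k + n)%N| + b <= \sum_i f i by rewrite f_sum lerD2r.
have sqr_f : \sum_i f i ^+ 2 <= K * (D k - D (k + n.+1)%N).
  apply: (le_trans (ler_sum _ (fun i _ => f_sqr i))).
  rewrite -mulr_sumr.
  suff -> : \sum_(i < n.+1) (D (k + i)%N - D (k + i).+1) = D k - D (k + n.+1)%N.
    by [].
  rewrite -(big_mkord xpredT (fun i => D (k + i)%N - D (k + i).+1)).
  under eq_bigr do rewrite -opprB -addnS.
  by rewrite sumrN telescope_sumr// opprB addn0.
have D_s : D k - D (k + n.+1)%N <= D k - D (k + s)%N.
  by rewrite lerB//; apply: D_mono; rewrite leq_add2l.
have f0 : 0 <= `|x k - x (k + n)%N| + b by rewrite addr_ge0.
apply: (@le_trans _ _ ((\sum_i f i) ^+ 2)).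
  by rewrite ler_sqr ?nnegrE// (le_trans f0).
apply: (le_trans (sqr_sum_le f)).
apply: ler_pM => //; first by apply: sumr_ge0 => i _; exact: sqr_ge0.
  by rewrite ler_nat.
by apply: (le_trans sqr_f); rewrite ler_pM2l.
Qed.

(** * Geometric rates *)

(** Comparing k with the last multiple of s before it loses at most [s.-1] steps,
hence the factor [q ^+ s.-1]. Its positivity allows [q = 0] only if [s = 1]. *)
Lemma geometric_decay_of_periodic (R : realType) (d : nat -> R) (q : R)
    (s : nat) :
  (0 < s)%N -> 0 <= q <= 1 -> 0 < q ^+ s.-1 ->
  (forall k, 0 <= d k) -> {homo d : i j / (i <= j)%N >-> j <= i} ->
  (forall k, d (k + s)%N <= q ^+ s * d k) ->
  forall k, d k <= d 0%N / q ^+ s.-1 * q ^+ k.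
Proof.
move=> s0 /andP[q0 q1] qs0 d0 d_mono ds k.
have dj j : d (j * s)%N <= q ^+ (j * s) * d 0%N.
  elim: j => [|j IHj]; first by rewrite mul0n expr0 mul1r.
  rewrite mulSnr (le_trans (ds _))// exprD mulrAC [leRHS]mulrC.
  by rewrite ler_wpM2l ?exprn_ge0.
apply: (@le_trans _ _ (d (k %/ s * s)%N)); first exact/d_mono/leq_trunc_div.
apply: (le_trans (dj _)); rewrite mulrC -mulrA ler_wpM2l// mulrC ler_pdivlMr//.
rewrite -exprD; apply: ler_wiXn2l => //.
by rewrite {1}(divn_eq k s) leq_add2l -ltnS prednK// ltn_mod.
Qed.

Lemma nth_root_exp (R : realType) n (a : R) : (0 < n)%N -> 0 <= a ->
  nth_root n a ^+ n = a.
Proof.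
move=> n0 a0; rewrite /nth_root -powR_mulrn ?powR_ge0// -powRrM.
by rewrite mulVf ?pnatr_eq0 -?lt0n// powRr1.
Qed.

(** If [s = 1] and [rho = 1] the rate q is 0, but then [q ^+ s.-1 = 1]; if
[2 <= s], then [rho / s < 1] and q is positive. *)
Lemma rate_bounds (R : realType) (s : nat) (rho : R) :
  (0 < s)%N -> 0 < rho <= 1 ->
  let q := nth_root (2 * s)%N (1 - rho / s%:R) in
  [/\ 0 <= q, q < 1, 0 < q ^+ s.-1 & (q ^+ s) ^+ 2 = 1 - rho / s%:R].
Proof.
move=> s0 /andP[rho0 rho1] q.
have sR0 : 0 < s%:R :> R by rewrite ltr0n.
have rs : rho / s%:R <= s%:R^-1 by rewrite ler_piMl ?invr_ge0 ?ler0n.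
have s1 : s%:R^-1 <= 1 :> R by rewrite invf_le1// ler1n.
have q0 : 0 <= q by exact: powR_ge0.
have qE : (q ^+ s) ^+ 2 = 1 - rho / s%:R.
  by rewrite -exprM mulnC nth_root_exp ?muln_gt0//; lra.
split=> //.
  rewrite ltNge; apply/negP => q1.
  have : 1 <= (q ^+ s) ^+ 2 by rewrite -exprM exprn_ege1.
  have : 0 < rho / s%:R by rewrite divr_gt0.
  by rewrite qE; lra.
case: s s0 @q sR0 rs s1 q0 qE => [//|[|s]] _ q sR0 rs _ _ _.
  by rewrite expr0.
apply: exprn_gt0; apply: powR_gt0; rewrite subr_gt0.
by apply: (le_lt_trans rs); rewrite invf_lt1// ltr1n.
Qed.

(** * The relaxed simultaneous cutter method *)

Section MaxFamily.
Variables (R : realType) (m : nat).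
Implicit Types (a : 'I_m -> R) (B : R).

Lemma le_fmax a i : a i <= fmax a.
Proof. exact: le_bigmax. Qed.

Lemma fmax_le a B : 0 <= B -> (forall i, a i <= B) -> fmax a <= B.
Proof. by move=> B0 aB; apply: bigmax_le. Qed.

End MaxFamily.

(** The constant K converts the decrease [a * (2 - a) * e] of the squared distance
into the squared step length [a ^+ 2 * e] and into the squared displacement of a
single operator, whose share in e is at least [wmin]. Both bounds rest on
[a / (2 - a)] being increasing, so at most [amax / (2 - amax)]. *)
Lemma relaxation_constant_bounds (R : realFieldType) (amin amax wmin a : R) :
  0 < amin <= 1 -> 0 < wmin <= 1 -> 1 <= amax < 2 -> amin <= a <= amax ->
  let K := amax / ((2 - amax) * wmin * amin ^+ 2) in
  [/\ 1 <= K, a ^+ 2 <= K * (a * (2 - a)) & 1 <= K * (a * (2 - a) * wmin)].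
Proof.
move=> /andP[am0 am1] /andP[w0 w1] /andP[aM1 aM2] /andP[aam aaM] K.
have M0 : 0 < 2 - amax by lra.
have am2 : 0 < amin ^+ 2 by rewrite exprn_gt0.
have den0 : 0 < (2 - amax) * wmin * amin ^+ 2 by rewrite !mulr_gt0.
have a0 : 0 < a by lra.
have aa : a * (2 - amax) <= amax * (2 - a) by lra.
have Ka : 1 <= K * (a * (2 - a) * wmin).
  rewrite /K mulrAC ler_pdivlMr// mul1r.
  have -> : (2 - amax) * wmin * amin ^+ 2 = amin ^+ 2 * (2 - amax) * wmin by ring.
  have -> : amax * (a * (2 - a) * wmin) = a * (amax * (2 - a)) * wmin by ring.
  rewrite ler_pM2r//; apply: (@le_trans _ _ (a * (a * (2 - amax)))).
    by rewrite mulrA -expr2 ler_pM2r// ler_sqr ?nnegrE//; lra.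
  by rewrite ler_pM2l.
split=> //.
  apply: (le_trans Ka); rewrite ler_piMr ?divr_ge0 ?(ltW den0)//; first lra.
  rewrite mulr_ile1 ?mulr_ge0 ?(ltW w0) ?(ltW a0)//; first lra.
  by have := sqr_ge0 (a - 1); lra.
rewrite /K mulrAC ler_pdivlMr//.
have -> : a ^+ 2 * ((2 - amax) * wmin * amin ^+ 2) =
          a * (a * (2 - amax)) * (wmin * amin ^+ 2) by ring.
have -> : amax * (a * (2 - a)) = a * (amax * (2 - a)) * 1 by ring.
apply: ler_pM.
- by rewrite ltW// !mulr_gt0.
- by rewrite ltW// mulr_gt0.
- by rewrite ler_pM2l.
- by rewrite mulr_ile1 ?(ltW w0) ?(ltW am2)// expr_le1// ltW.
Qed.

Theorem theorem17 (R : realType) (H : completeNormedModType R)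
    (dot : {dot H for idfun}) (hdot : induces_norm dot)
    (m : nat) (U : 'I_m -> H -> H) (p : 'I_m -> H -> R) (Cs : 'I_m -> set H)
    (hU : forall i, cutter dot (U i))
    (hp : forall i z, 0 <= p i z)
    (hCU : forall i, Cs i = Fix (U i))
    (hCp : forall i, Cs i = p i @^-1` [set 0])
    (C : set H) (hC : C = \bigcap_i Cs i) (hC0 : C !=set0)
    (x : nat -> H) (I J : nat -> {set 'I_m})
    (alpha : nat -> R) (omega : nat -> 'I_m -> R)
    (hx : forall k, x k.+1 =
       x k + alpha k *: (\sum_(i in I k) omega k i *: U i (x k) - x k))
    (hIJ : forall k, (I k \subset J k))
    (halpha : forall k, 0 < alpha k < 2)
    (homega : forall k i, i \in I k -> 0 < omega k i <= 1)
    (homega1 : forall k, \sum_(i in I k) omega k i = 1)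
    (* (i) *)
    (amin amax wmin : R)
    (hamin : 0 < amin <= 1) (hwmin : 0 < wmin <= 1) (hamax : 1 <= amax < 2)
    (halpha_i : forall k, amin <= alpha k <= amax)
    (homega_i : forall k i, i \in I k -> wmin <= omega k i <= 1)
    (* (ii) *)
    (s : nat) (hs : (1 <= s)%N)
    (hJ : forall k, (\bigcup_(k <= l < k + s) J l = [set: 'I_m])%SET)
    (* (iii) *)
    (hargmax : forall k,
       (I k :&: Argmax (J k) (fun j => p j (x k)))%SET != finset.set0)
    (* (iv) *)
    (r : R) (hr : r = dist (x 0%N) C) (hr0 : 0 < r)
    (delta Delta : R) (hdelta : 0 < delta) (hDelta : 0 < Delta)
    (hiv : forall z i, closed_ball_ Num.norm (metric_proj C (x 0%N)) r z ->
       delta * dist z (Cs i) <= p i z /\ p i z <= Delta * `|U i z - z|)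
    (kappa : R)
    (hreg : linearly_regular (fun i => Fix (U i))
       (closed_ball_ Num.norm (metric_proj C (x 0%N)) r) kappa) :
  let q := nth_root (2 * s)%N
    (1 - wmin * (2 - amax) * amin ^+ 2 / (s%:R * amax)
         * (delta / (kappa * Delta)) ^+ 2) in
  let c := 2 * dist (x 0%N) C / q ^+ s.-1 in
  exists xoo : H,
    [/\ C xoo,
        converges_linearly x xoo c q &
        forall k : nat,
          delta / (2 * kappa) * `|x k - xoo| <= fmax (fun i => p i (x k)) /\
          fmax (fun i => p i (x k)) <= Delta * c * q ^+ k].
Proof.
move=> q c.
set P := metric_proj C (x 0%N) in hiv hreg.
have CE : C = \bigcap_i Fix (U i).
  by rewrite hC; apply: eq_bigcapr => i _; exact: hCU.
have C_Fix z i : C z -> Fix (U i) z by rewrite CE; apply.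
have C_closed : closed C.
  by rewrite CE; apply: closed_bigI => i _; exact: cutter_Fix_closed hdot _ (hU i).
have C_mid y z : C y -> C z -> C (2^-1 *: (y + z)).
  rewrite CE => Cy Cz i _.
  exact: (cutter_Fix_midpoint hdot (hU i) (Cy i _) (Cz i _)).
have [CP xP] := metric_projP hdot (x 0%N) hC0 C_closed C_mid.
rewrite -/P -hr in CP xP.
pose e k := \sum_(i in I k) omega k i * `|U i (x k) - x k| ^+ 2.
have step k z : C z -> `|x k.+1 - x k| ^+ 2 <= alpha k ^+ 2 * e k /\
    `|x k.+1 - z| ^+ 2 <= `|x k - z| ^+ 2 - alpha k * (2 - alpha k) * e k.
  move=> Cz; have xE : x k.+1 =
      x k + alpha k *: \sum_(i in I k) omega k i *: (U i (x k) - x k).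
    rewrite hx; congr (_ + _ *: _); under [RHS]eq_bigr do rewrite scalerBr.
    by rewrite sumrB -scaler_suml homega1 scale1r.
  have [a0 a2] := andP (halpha k).
  have w0 i : i \in I k -> 0 <= omega k i by case/homega/andP => /ltW.
  have u_dot i : i \in I k ->
      dot (x k - z) (U i (x k) - x k) <= - `|U i (x k) - x k| ^+ 2.
    by move=> _; apply: (cutter_dot hdot _ (hU i)); exact: C_Fix.
  have [ve xz] := relaxed_step hdot (ltW a0) w0 (homega1 k) u_dot.
  rewrite xE; split=> //.
  rewrite addrAC subrr add0r normrZ exprMn real_normK ?num_real//.
  by rewrite ler_wpM2l ?sqr_ge0.
have e_ge0 k : 0 <= e k.
  apply: sumr_ge0 => i /homega/andP[w0 _].
  by rewrite mulr_ge0 ?sqr_ge0// ltW.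
have fejer k z : C z -> `|x k.+1 - z| <= `|x k - z|.
  move=> /(step k)[_]; have /andP[a0 a2] := halpha k.
  have : 0 <= alpha k * (2 - alpha k) * e k.
    by rewrite !mulr_ge0// ?subr_ge0 ltW.
  by move=> ? ?; rewrite -ler_sqr ?nnegrE//; lra.
have fejer_le k l z : C z -> (k <= l)%N -> `|x l - z| <= `|x k - z|.
  move=> Cz /subnKC <-; elim: (l - k)%N => [|n IHn]; first by rewrite addn0.
  by rewrite addnS (le_trans (fejer _ _ Cz)).
have x_ball k : closed_ball_ Num.norm P r (x k).
  by rewrite /closed_ball_ /= distrC -xP; exact: fejer_le.
have p_ge k i : delta * dist (x k) (Fix (U i)) <= p i (x k).
  by have [] := hiv _ i (x_ball k); rewrite hCU.
have p_le k i : p i (x k) <= Delta * `|U i (x k) - x k|.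
  by have [] := hiv _ i (x_ball k).
have [kappa0 reg] := hreg; rewrite -CE in reg.
have {}reg k := reg _ (x_ball k).
have dist_Fix k i : dist (x k) (Fix (U i)) <= dist (x k) C.
  by apply: dist_subset => // z; exact: C_Fix.
(* Both bounds come from x_0, which is at positive distance r from C: regularity
   at x_0 reads r <= kappa * r at worst, and Delta < delta would put x_0 at
   distance 0 from every Fix (U i). *)
have kappa1 : 1 <= kappa.
  rewrite -(ler_pM2r hr0) mul1r {1}hr (le_trans (reg 0%N))// ler_pM2l//.
  by rewrite hr; apply: fmax_le => //; exact: dist_ge0.
have deltaDelta : delta <= Delta.
  rewrite leNgt; apply/negP => Dd.
  suff : fmax (fun i => dist (x 0%N) (Fix (U i))) <= 0.
    rewrite -(pmulr_rle0 _ kappa0) => /(le_trans (reg 0%N)).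
    by rewrite -hr leNgt hr0.
  apply: fmax_le => //= i; rewrite -(@pmulr_rle0 _ (delta - Delta)) ?subr_gt0//.
  have := cutter_displacement_le_dist hdot (x 0%N) (hU i).
  move/(ler_wpM2l (ltW hDelta)); rewrite mulrBl.
  by have := p_ge 0%N i; have := p_le 0%N i; lra.
(* The displacement enters the estimate of d(x_k, C_i) multiplied by
   Delta / delta, whence the square of this ratio in K; as the ratio is at least
   1, K is large enough for the steps as well. *)
pose K0 := amax / ((2 - amax) * wmin * amin ^+ 2).
pose K := (Delta / delta) ^+ 2 * K0.
pose rho := (kappa ^+ 2 * K)^-1.
have G1 : 1 <= (Delta / delta) ^+ 2.
  by apply: exprn_ege1; rewrite ler_pdivlMr// mul1r.
have K0_bnd k : [/\ 1 <= K0, alpha k ^+ 2 <= K0 * (alpha k * (2 - alpha k))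
    & 1 <= K0 * (alpha k * (2 - alpha k) * wmin)].
  exact: relaxation_constant_bounds hamin hwmin hamax (halpha_i k).
have K0_ge1 : 1 <= K0 by have [] := K0_bnd 0%N.
have K0_gt0 : 0 < K0 by exact: lt_le_trans K0_ge1.
have K_ge : K0 <= K by rewrite ler_peMl// ltW.
have K_gt0 : 0 < K by exact: lt_le_trans K_ge.
have rho_bnd : 0 < rho <= 1.
  have k2K : 0 < kappa ^+ 2 * K by rewrite mulr_gt0 ?exprn_gt0.
  rewrite invr_gt0 k2K invf_le1//=.
  by rewrite -[1]mulr1 ler_pM ?exprn_ege1// (le_trans K0_ge1).
have qE : q = nth_root (2 * s)%N (1 - rho / s%:R).
  rewrite /q /rho /K /K0; congr (nth_root _ (1 - _)).
  have [[/andP[w0 _] /andP[am0 _]] /andP[aM1 aM2]] := (hwmin, hamin, hamax).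
  by field; rewrite !gt_eqF ?ltr0n//; lra.
have [q0 q1 qs0 qs2] := rate_bounds hs rho_bnd; rewrite -qE in q0 q1 qs0 qs2.
have step_le k z : C z ->
    `|x k.+1 - x k| ^+ 2 <= K * (`|x k - z| ^+ 2 - `|x k.+1 - z| ^+ 2).
  move=> /(step k)[xx xz].
  have [_ aK _] := K0_bnd k.
  have /andP[a0 a2] := halpha k.
  apply: (le_trans xx); apply: (le_trans (ler_wpM2r (e_ge0 k) aK)).
  rewrite -mulrA; apply: ler_pM => //; [exact: ltW| |by move: xz; lra].
  by rewrite !mulr_ge0// ?subr_ge0 ltW.
have cutter_le k z j : C z -> j \in I k ->
    (Delta / delta * `|U j (x k) - x k|) ^+ 2 <=
    K * (`|x k - z| ^+ 2 - `|x k.+1 - z| ^+ 2).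
  move=> /(step k)[_ xz] jI.
  have [_ _ aK] := K0_bnd k.
  have /andP[a0 a2] := halpha k.
  rewrite exprMn /K -mulrA ler_wpM2l ?sqr_ge0//.
  have ej : wmin * `|U j (x k) - x k| ^+ 2 <= e k.
    rewrite /e (bigD1 j)//=; apply: ler_wpDr.
      apply: sumr_ge0 => i /andP[/homega/andP[w0 _] _].
      by rewrite mulr_ge0 ?sqr_ge0// ltW.
    by rewrite ler_wpM2r ?sqr_ge0//; have /andP[] := homega_i k j jI.
  apply: (le_trans (ler_peMl (sqr_ge0 _) aK)).
  rewrite -(mulrA K0) ler_pM2l//.
  have := ler_wpM2l (ltW (mulr_gt0 a0 (_ : 0 < 2 - alpha k))) ej.
  by rewrite subr_gt0 => /(_ a2); lra.
(* The choice of y as the point nearest to x_k makes |x_k - y| equal to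
   d(x_k, C), while d(x_(k+s), C) is at most |x_(k+s) - y|. *)
have cycle k :
    dist (x (k + s)%N) C ^+ 2 <= (1 - rho / s%:R) * dist (x k) C ^+ 2.
  have [y Cy yd] := nearest_point_exists hdot (x k) hC0 C_closed C_mid.
  pose E := s%:R * (K * (`|x k - y| ^+ 2 - `|x (k + s)%N - y| ^+ 2)).
  have dist_E i : dist (x k) (Fix (U i)) ^+ 2 <= E.
    have [l lks il] : exists2 l, (k <= l < k + s)%N & i \in J l.
      have : i \in (\bigcup_(k <= l < k + s) J l)%SET by rewrite hJ inE.
      rewrite big_tnth => /finset.bigcupP[n _ iJ].
      exists (tnth (in_tuple (index_iota k (k + s))) n) => //.
      by rewrite -mem_index_iota mem_tnth.
    have /set0Pn[j] := hargmax l; rewrite !inE => /and3P[jI jJ /forall_inP pj].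
    pose b := Delta / delta * `|U j (x l) - x l|.
    have b0 : 0 <= b by rewrite mulr_ge0 ?divr_ge0 ?(ltW hDelta) ?(ltW hdelta).
    have dist_b : dist (x l) (Fix (U i)) <= b.
      rewrite /b mulrAC ler_pdivlMr// mulrC.
      by apply: (le_trans (p_ge l i)); apply: (le_trans (pj i il)).
    have hE := sqr_path_le K_gt0 lks (fun n => step_le n y Cy) b0
      (cutter_le l y j Cy jI).
    apply: le_trans hE; rewrite ler_sqr ?nnegrE ?addr_ge0 ?dist_ge0//.
    by apply: (le_trans (dist_triangle _ (x l) _)); rewrite lerD2l.
  have E0 : 0 <= E.
    rewrite /E pmulr_rge0 ?ltr0n// pmulr_rge0// subr_ge0 ler_sqr ?nnegrE//.
    by apply: fejer_le => //; exact: leq_addr.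
  have max_E : fmax (fun i => dist (x k) (Fix (U i))) <= Num.sqrt E.
    apply: fmax_le => [|i]; first exact: sqrtr_ge0.
    by rewrite -(ger0_norm (dist_ge0 _ _)) -sqrtr_sqr ler_wsqrtr.
  have : dist (x k) C ^+ 2 <= kappa ^+ 2 * E.
    rewrite -[E]sqr_sqrtr// -exprMn ler_sqr ?nnegrE ?dist_ge0//; last first.
      by rewrite mulr_ge0 ?sqrtr_ge0 ?(ltW kappa0).
    by apply: (le_trans (reg k)); rewrite ler_pM2l.
  have -> : kappa ^+ 2 * E =
      s%:R / rho * (`|x k - y| ^+ 2 - `|x (k + s)%N - y| ^+ 2).
    by rewrite /E /rho invrK; ring.
  have /andP[rho0 _] := rho_bnd; have s0 : 0 < s%:R :> R by rewrite ltr0n.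
  rewrite -ler_pdivrMl ?divr_gt0// invf_div yd.
  have : dist (x (k + s)%N) C ^+ 2 <= `|x (k + s)%N - y| ^+ 2.
    by rewrite ler_sqr ?nnegrE ?dist_ge0// dist_le.
  by lra.
have dist_noninc : {homo (fun k => dist (x k) C) : i j / (i <= j)%N >-> j <= i}.
  move=> i j ij; apply: le_dist => // z Cz.
  by rewrite (le_trans (dist_le _ Cz))// fejer_le.
have dist_decay k : 2 * dist (x k) C <= c * q ^+ k.
  have : dist (x k) C <= dist (x 0%N) C / q ^+ s.-1 * q ^+ k.
    apply: (@geometric_decay_of_periodic _ (fun k => dist (x k) C) q s) => //.
    - by rewrite q0 ltW.
    - by move=> j; exact: dist_ge0.
    - move=> j; rewrite -ler_sqr ?nnegrE ?mulr_ge0 ?exprn_ge0 ?dist_ge0//.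
      by rewrite exprMn qs2.
  by rewrite /c -!mulrA ler_pM2l.
have decay0 : 2 * dist (x k) C @[k --> \oo] --> 0.
  have geo0 : c * q ^+ k @[k --> \oo] --> 0.
    by apply: cvg_geometric; rewrite ger0_norm.
  apply: (squeeze_cvgr _ (@cvg_cst _ 0 _ _ _) geo0); apply: nearW => k.
  by rewrite mulr_ge0 ?dist_ge0//= dist_decay.
have [L xL xkL] : exists2 L, x @ \oo --> L &
    forall k, `|x k - L| <= 2 * dist (x k) C.
  apply: cauchy_tail_limit => // k l kl.
  have [y Cy yd] := nearest_point_exists hdot (x k) hC0 C_closed C_mid.
  rewrite (le_trans (ler_distD y _ _))// mulr_natl mulr2n -yd (distrC y) lerD2r.
  exact: fejer_le.
have CL : C L.
  have [y Cy Ly] := nearest_point_exists hdot L hC0 C_closed C_mid.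
  suff : `|L - y| <= 0 by rewrite normr_le0 subr_eq0 => /eqP ->.
  rewrite Ly; apply/ler_addgt0Pr => eps eps0; rewrite add0r.
  have e2 : 0 < eps / 2 by rewrite divr_gt0.
  have [k] := filter_ex (cvgr_lt _ decay0 _ e2).
  have := dist_triangle L (x k) C; rewrite distrC; have := xkL k.
  by have := dist_ge0 (x k) C; lra.
have xkL_le k : `|x k - L| <= c * q ^+ k by exact: le_trans (xkL k) _.
exists L; split=> // k; split.
  have : dist (x k) C <= kappa * (fmax (fun i => p i (x k)) / delta).
    rewrite (le_trans (reg k))// ler_pM2l//; apply: fmax_le => [|i].
      by rewrite divr_ge0 ?(ltW hdelta)// bigmax_ge_id.
    by rewrite ler_pdivlMr// mulrC (le_trans (p_ge k i))// le_fmax.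
  rewrite mulrA ler_pdivlMr// mulrAC ler_pdivrMr ?mulr_gt0// => pk.
  have := ler_wpM2l (ltW hdelta) (xkL k); lra.
apply: fmax_le => [|i].
  by rewrite -mulrA mulr_ge0 ?(ltW hDelta)// (le_trans _ (xkL_le k)).
rewrite (le_trans (p_le k i))// -mulrA ler_pM2l// (le_trans _ (xkL_le k))//.
by apply: cutter_displacement_le hdot _ _ _ (hU i) _; exact: C_Fix.
Qed.
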